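(* There exists a positive integer $\Delta_0$ such that for every integer $\Delta \geq \Delta_0$, every graph of maximum degree at most $\Delta$ has a proper conflict-free colouring with at most $\Delta+100106\,\Delta^{2/3}\log\Delta$ colours.
   Context: All graphs are finite and simple, and $\log$ denotes the natural logarithm. A proper colouring of a graph is an assignment of colours to its vertices such that adjacent vertices receive different colours. A proper conflict-free colouring of a graph $G$ is a proper colouring of $G$ such that for every non-isolated vertex $v$ of $G$, some neighbour of $v$ receives a colour that is received by no other neighbour of $v$. *)

(* Defs.v *)
From mathcomp Require Import all_boot all_order all_algebra.
From mathcomp Require Import reals exp.

Set Implicit Arguments.
Unset Strict Implicit.
Unset Printing Implicit Defensive.

Definition simple_graph (T : finType) (e : rel T) : Prop :=
  symmetric e /\ irreflexive e.

Definition neighbours (T : finType) (e : rel T) (v : T) : {set T} :=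
  [set u | e v u].

Definition max_degree (T : finType) (e : rel T) : nat :=
  \max_(v : T) #|neighbours e v|.

Definition proper_colouring (T : finType) (C : eqType) (e : rel T)
    (c : T -> C) : Prop :=
  forall u v : T, e u v -> c u != c v.

Definition proper_conflict_free_colouring (T : finType) (C : eqType)
    (e : rel T) (c : T -> C) : Prop :=
  proper_colouring e c /\
  forall v : T, neighbours e v != set0 ->
    exists2 u : T, u \in neighbours e v &
      forall w : T, w \in neighbours e v -> w != u -> c w != c u.

(* Main.v *)
Require Import Defs.
From mathcomp Require Import all_boot all_order all_algebra.
From mathcomp Require Import reals exp.
From mathcomp Require Import sequences ring lra zify.

Set Implicit Arguments.
Unset Strict Implicit.
Unset Printing Implicit Defensive.

Import Order.TTheory GRing.Theory Num.Theory.
Local Open Scope ring_scope.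

(** Call a vertex low if its degree is below Delta^(1/3). Choose a random set S
of vertices, each of them in S with probability p of order Delta^(-1/3) log Delta,
and colour S at random from a palette of q ~ 256 Delta^(2/3) log Delta colours.
An edge is monochromatic inside S with probability about p^2/q; so is a
low vertex v whose neighbourhood lies in S and shows no unique colour, and
a vertex that is not low has no unique colour on its neighbours in S with
probability at most exp(- p deg(v) / 2). A counting version of the local lemma
(Rosenfeld) avoids all these events simultaneously. The vertices outside S are
then coloured greedily with Delta + 1 other colours, the low ones last, keeping
a unique colour around every low vertex with a neighbour outside S.

To make the colours independent, each pair (vertex, colour) carries its own
random bit; a vertex with two bits is one more rare bad event. *)

(** * Uniform probability on a finite product space, independence, and the counting local lemma *)

Section ProductSpace.
Variables (R : realFieldType) (I : finType) (n : nat).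
Local Notation Omega := {ffun I -> 'I_n.+1}.
Implicit Types (A B : pred Omega) (S : {set I}).

Definition prob A : R := #|[set f | A f]|%:R / #|{: Omega}|%:R.

Definition depends_on A S := forall f g : Omega, {in S, f =1 g} -> A f = A g.

Lemma card_Omega_gt0 : 0 < #|{: Omega}|%:R :> R.
Proof. by rewrite ltr0n; apply/card_gt0P; exists [ffun=> ord0]. Qed.

Lemma prob_ge0 A : 0 <= prob A.
Proof. by rewrite divr_ge0 ?ler0n. Qed.

Lemma prob_true A : (forall f, A f) -> prob A = 1.
Proof.
move=> At; rewrite /prob (_ : [set f | A f] = setT); last first.
  by apply/setP => f; rewrite !inE At.
by rewrite cardsT divff ?lt0r_neq0 ?card_Omega_gt0.
Qed.

Lemma prob_gt0_ex A : 0 < prob A -> exists f, A f.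
Proof.
rewrite /prob; case: (set_0Vmem [set f | A f]) => [->|[f]].
  by rewrite cards0 mul0r ltxx.
by rewrite inE; exists f.
Qed.

Lemma prob_sub A B : (forall f, A f -> B f) -> prob A <= prob B.
Proof.
move=> AB; rewrite /prob ler_wpM2r ?invr_ge0 ?ler0n// ler_nat.
by apply/subset_leq_card/subsetP => f; rewrite !inE; apply: AB.
Qed.

Lemma eq_prob A B : A =1 B -> prob A = prob B.
Proof. by move=> AB; apply/le_anti; rewrite !prob_sub// => f; rewrite AB. Qed.

Lemma prob_compl A : prob (fun f => ~~ A f) = 1 - prob A.
Proof.
apply/(addIr (prob A)); rewrite subrK /prob -mulrDl -natrD addnC.
rewrite (_ : [set f | ~~ A f] = ~: [set f | A f]); last first.
  by apply/setP => f; rewrite !inE.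
by rewrite cardsC divff ?lt0r_neq0 ?card_Omega_gt0.
Qed.

Lemma prob_split A B :
  prob A = prob (fun f => A f && B f) + prob (fun f => A f && ~~ B f).
Proof.
rewrite /prob -mulrDl -natrD -(cardsID [set f | B f] [set f | A f]).
by congr ((_ + _)%:R / _); apply: eq_card => f; rewrite !inE // andbC.
Qed.

Lemma prob_union_le (J : finType) (U : pred J) (A : J -> pred Omega) :
  prob (fun f => [exists k in U, A k f]) <= \sum_(k in U) prob (A k).
Proof.
rewrite /prob -mulr_suml ler_wpM2r ?invr_ge0 ?ler0n// -natr_sum ler_nat.
rewrite (_ : [set f | _] = \bigcup_(k in U) [set f | A k f]).
  elim/big_rec2: _ => [|k X m _ IH]; first by rewrite cards0.
  by rewrite (leq_trans (leq_card_setU _ _)) ?leq_add2l.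
apply/setP => f; rewrite inE; apply/existsP/bigcupP => -[k].
  by case/andP=> Uk Akf; exists k; rewrite ?inE.
by move=> Uk; rewrite inE => Akf; exists k; apply/andP; split.
Qed.

Lemma prob_union_disjoint (J : finType) (U : pred J) (A : J -> pred Omega) :
  (forall f, {in U &, forall j k, A j f -> A k f -> j = k}) ->
  prob (fun f => [exists k in U, A k f]) = \sum_(k in U) prob (A k).
Proof.
move=> dis; rewrite /prob -mulr_suml -natr_sum; congr (_%:R / _).
under eq_bigr do rewrite -sum1_card big_mkcond/=.
rewrite exchange_big/= -sum1_card big_mkcond/=; apply: eq_bigr => f _.
rewrite inE; case: existsP => [[k /andP[Uk Akf]]|noex].
  rewrite (bigD1 k)//= inE Akf big1 ?addn0// => j /andP[Uj /eqP jk].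
  by rewrite inE; case: ifP => // Ajf; case: jk; apply: dis Ajf Akf.
rewrite big1// => k Uk; rewrite inE; case: ifP => // Akf.
by case: noex; exists k; apply/andP; split.
Qed.

(* Exchanging the coordinates outside [S] of a pair of points is an involution. *)
Lemma prob_indep A B S : depends_on A S -> depends_on B (~: S) ->
  prob (fun f => A f && B f) = prob A * prob B.
Proof.
move=> dA dB.
pose sw (x : Omega * Omega) : Omega * Omega :=
  ([ffun i => if i \in S then x.1 i else x.2 i],
   [ffun i => if i \in S then x.2 i else x.1 i]).
have swK : involutive sw.
  case=> f g; rewrite /sw /=.
  by congr pair; apply/ffunP => i; rewrite !ffunE /= ?ffunE; case: (i \in S).
have E : setX [set f | A f] [set f | B f] =
    sw @^-1: setX [set f | A f && B f] setT.
  apply/setP => -[f g]; rewrite !inE /= andbT; congr (_ && _).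
    by apply: dA => i iS; rewrite ffunE /= iS.
  by apply: dB => i; rewrite inE ffunE /= => /negbTE->.
have : (#|[set f | A f]| * #|[set f | B f]| =
    #|[set f | A f && B f]| * #|{: Omega}|)%N.
  rewrite -cardsX E card_preimset; last exact: (inv_inj swK).
  by rewrite cardsX cardsT.
move=> /(congr1 (fun m => m%:R : R)); rewrite !natrM /prob => H.
have := lt0r_neq0 card_Omega_gt0; set w := _%:R in H * => w0.
by rewrite mulf_div H; field.
Qed.

Lemma depends_onW A S S' : S \subset S' -> depends_on A S -> depends_on A S'.
Proof. by move=> SS' dA f g fg; apply: dA => i /(subsetP SS') /fg. Qed.

(** The fibres of [h] are disjoint blocks of coordinates, so [prob_indep] splits off one event at a
    time. Later [h] is a projection: [fst] makes the blocks vertices, [snd] makes them colours. *)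
Lemma prob_indep_all (J : finType) (h : I -> J) (A : J -> pred Omega) (U : {set J}) :
  (forall k, depends_on (A k) (h @^-1: [set k])) ->
  prob (fun f => [forall k in U, A k f]) = \prod_(k in U) prob (A k).
Proof.
move=> dA; have [m] := ubnP #|U|; elim: m U => // m IH U.
have [->|[k kU]] := set_0Vmem U.
  by move=> _; rewrite big_set0 prob_true// => f; apply/forall_inP => j; rewrite inE.
rewrite (cardsD1 k) kU ltnS => Um; rewrite (big_setD1 k)//= -IH//.
rewrite -(prob_indep (S := h @^-1: [set k]))//.
  apply: eq_prob => f; apply/forall_inP/andP => [Af|[Akf /forall_inP Af] j jU].
    by split; [apply: Af|apply/forall_inP => j; rewrite inE => /andP[_ /Af]].
  by have [->//|jk] := eqVneq j k; apply: Af; rewrite !inE jk.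
move=> f g fg; apply: eq_forallb_in => j; rewrite inE => /andP[jk _].
apply: dA => i; rewrite !inE => /eqP hi; apply: fg; rewrite !inE hi.
by move: jk; rewrite inE.
Qed.

Lemma prob_coord (i : I) (a : 'I_n.+1) : prob (fun f => f i == a) = n.+1%:R^-1.
Proof.
(* With [a] as default value, the functions taking the value [a] at [i] are those supported off
   [i]. *)
have cA : #|[set f : Omega | f i == a]| = (n.+1 ^ #|predC1 i|)%N.
  rewrite -[n.+1 in RHS]card_ord -(card_pffun_on a); apply: eq_card => f.
  rewrite inE; apply/idP/pffun_onP => [/eqP fi|[/supportP sf _]].
    by split=> //; apply/supportP => x; rewrite inE negbK => /eqP->.
  by rewrite sf// inE eqxx.
have I0 : (0 < #|I|)%N by apply/card_gt0P; exists i.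
rewrite /prob cA card_ffun card_ord cardC1 -{2}(prednK I0) expnSr natrM invfM.
by rewrite mulVKf// pnatr_eq0 expn_eq0.
Qed.

(* Rosenfeld's counting form of the local lemma: revealing one more coordinate
   block keeps at least a proportion [b] of the good configurations. *)
Lemma avoid_events_ex (T K : finType) (h : I -> T) (ev : K -> pred Omega)
    (sc : K -> {set T}) (b : R) :
  0 < b ->
  (forall k, depends_on (ev k) (h @^-1: sc k)) ->
  (forall k f, ev k f -> sc k != set0) ->
  (forall u, \sum_(k | u \in sc k) prob (ev k) / b ^+ #|sc k|.-1 <= 1 - b) ->
  exists f, forall k, ~~ ev k f.
Proof.
move=> b0 dev sc0 hsum.
pose good (X : {set T}) f := [forall (k | sc k \subset X), ~~ ev k f].
have good_dep X : depends_on (good X) (h @^-1: X).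
  move=> f g fg; apply: eq_forallb_in => k kX; congr (~~ _); apply: dev => i.
  by rewrite inE => /(subsetP kX) iX; apply: fg; rewrite inE.
have goodS (X Y : {set T}) f : Y \subset X -> good X f -> good Y f.
  move=> YX /forall_inP gX; apply/forall_inP => k kY.
  exact/gX/(subset_trans kY YX).
have step m (X Y : {set T}) : (#|X| <= m)%N -> Y \subset X ->
    b ^+ (#|X| - #|Y|) * prob (good Y) <= prob (good X).
  elim: m X Y => [|m IH] X Y Xm YX.
    move: Xm YX; rewrite leqn0 cards_eq0 => /eqP->; rewrite subset0 => /eqP->.
    by rewrite subnn mul1r.
  have [XY|/subsetPn[u uX uY]] := boolP (X \subset Y).
    by rewrite (_ : X = Y) ?subnn ?mul1r//; apply/eqP; rewrite eqEsubset XY.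
  pose X' := X :\ u.
  have cX : #|X| = #|X'|.+1 by rewrite (cardsD1 u) uX.
  have X'm : (#|X'| <= m)%N by rewrite -ltnS -cX.
  have YX' : Y \subset X' by rewrite subsetD1 YX.
  rewrite cX subSn ?subset_leq_card// exprS -mulrA.
  apply: (le_trans (ler_wpM2l (ltW b0) (IH _ _ X'm YX'))).
  have -> : prob (good X) =
      prob (good X') - prob (fun f => good X' f && ~~ good X f).
    rewrite [prob (good X')](prob_split _ (good X)) addrK; apply: eq_prob => f.
    by apply/idP/andP => [gX|[]//]; split=> //; apply: goodS gX; apply: subsetDl.
  suff bad : prob (fun f => good X' f && ~~ good X f) <= (1 - b) * prob (good X').
    by rewrite -(opprK (b * _)) -(subrKA (prob (good X'))) opprK; lra.
  (* If [good] holds on [X'] but fails on [X], the culprit event has [u] in its scope. The condition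
     on [X'] is weakened to [good] off that scope, which makes it independent of the culprit. *)
  apply: (le_trans (prob_sub (B := fun f =>
      [exists k in [pred k | (u \in sc k) && (sc k \subset X)],
        ev k f && good (X :\: sc k) f]) _)).
    move=> f /andP[gX' /forall_inPn[k kX]]; rewrite negbK => evk.
    have {}kX : sc k \subset X by [].
    have uk : u \in sc k.
      apply: contraLR evk => uk; apply: (forall_inP gX').
      by rewrite subsetD1 kX.
    apply/existsP; exists k; rewrite inE uk kX evk /=.
    by apply: goodS gX'; rewrite subsetD1 subsetDl inE uk.
  apply: (le_trans (prob_union_le _ _)).
  have indep k : prob (fun f => ev k f && good (X :\: sc k) f) =
      prob (ev k) * prob (good (X :\: sc k)).
    apply: (prob_indep (S := h @^-1: sc k)) => //.
    apply: depends_onW (good_dep _); apply/subsetP => i.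
    by rewrite !inE => /andP[].
  apply: (@le_trans _ _ (\sum_(k | (u \in sc k) && (sc k \subset X))
      prob (ev k) / b ^+ #|sc k|.-1 * prob (good X'))).
    apply: ler_sum => k /andP[uk kX]; rewrite indep -mulrA.
    apply: ler_wpM2l; first exact: prob_ge0.
    (* The induction hypothesis pays for restoring the rest of the scope: [X'] has [#|sc k|.-1] more
       vertices than [X :\: sc k], since [u] is missing from both. *)
    rewrite ler_pdivlMl ?exprn_gt0//.
    apply: le_trans (IH _ (X :\: sc k) X'm _); last first.
      by rewrite subsetD1 subsetDl inE uk.
    rewrite (_ : (#|X'| - #|X :\: sc k|)%N = #|sc k|.-1)//.
    move: (cardsID (sc k) X); rewrite setIC (setIidPl kX) cX (cardsD1 u (sc k)) uk.
    lia.
  rewrite -mulr_suml ler_wpM2r ?prob_ge0//.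
  apply: le_trans (hsum u); rewrite [leRHS](bigID (fun k => sc k \subset X))/=.
  rewrite lerDl sumr_ge0// => k _.
  by rewrite divr_ge0 ?prob_ge0 ?exprn_ge0 ?(ltW b0).
have good0 : prob (good set0) = 1.
  apply: prob_true => f; apply/forall_inP => k; rewrite subset0 => /eqP k0.
  by apply/negP => /sc0; rewrite k0 eqxx.
have : 0 < prob (good setT).
  apply: lt_le_trans (step _ _ _ (leqnn _) (sub0set setT)).
  by rewrite good0 mulr1 exprn_gt0.
case/prob_gt0_ex => f /forall_inP gf; exists f => k; apply: gf.
exact: subsetT.
Qed.
End ProductSpace.
Arguments prob_sub {R I n A} B.
Arguments eq_prob {R I n A} B.
Arguments depends_onW {I n A S S'}.
Arguments prob_indep {R I n A B S}.
Arguments prob_indep_all {R I n J h A} U.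
Arguments avoid_events_ex {R I n T K} h {ev} sc {b}.

(** * Greedy colouring of the vertices outside the random set *)

Section Greedy.
Variables (T : finType) (e : rel T) (low : {set T}) (Delta : nat).
Hypotheses (e_sym : symmetric e) (e_irr : irreflexive e).
Hypothesis deg_le : forall v, (#|neighbours e v| <= Delta)%N.
Hypothesis low_deg_le : forall v, v \in low -> (2 * #|neighbours e v| <= Delta)%N.
Local Notation N := (neighbours e).

Definition unique_in (C : eqType) (c : T -> C) (A : {set T}) (u : T) : bool :=
  (u \in A) && [forall w in A, (w != u) ==> (c w != c u)].

(** A partial colouring is encoded as a total function together with its domain [Y]; its values off
    [Y] carry no meaning. *)
Definition greedy_good (Y : {set T}) (c : T -> 'I_Delta.+1) : Prop :=
  {in Y &, forall u v, e u v -> c u != c v} /\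
  {in low, forall v, N v :&: Y != set0 -> exists u, unique_in c (N v :&: Y) u}.

(* A vertex [u] avoids the colours of its coloured neighbours, and the colour
   currently unique at each low neighbour: these two families of neighbours
   are disjoint when no low vertex has been coloured yet. *)
Lemma greedy_step (Y : {set T}) (c : T -> 'I_Delta.+1) (u : T) :
  greedy_good Y c -> u \notin Y -> u \in low \/ Y :&: low = set0 ->
  exists c', greedy_good (u |: Y) c'.
Proof.
move=> [cY clow] uY ulow.
pose wit v := odflt v [pick x | unique_in c (N v :&: Y) x].
pose forb := c @: (N u :&: Y) :|: (c \o wit) @: (N u :&: low).
have forb_le : (#|forb| < #|'I_Delta.+1|)%N.
  rewrite card_ord ltnS (leq_trans (leq_card_setU _ _))//.
  apply: leq_trans (leq_add (leq_imset_card _ _) (leq_imset_card _ _)) _.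
  have sub (A : {set T}) : (#|N u :&: A| <= #|N u|)%N.
    exact/subset_leq_card/subsetIl.
  (* For a low [u] each of the two families has at most [Delta / 2] members, so they may overlap. *)
  case: ulow => [/low_deg_le|Ylow].
    by have := sub Y; have := sub low; lia.
  rewrite -cardsUI setIACA Ylow setI0 cards0 addn0 -setIUr.
  exact: leq_trans (sub _) (deg_le _).
have [a aforb] : exists a, a \notin forb.
  apply/existsP; rewrite -negb_forall; apply/negP => /forallP all_forb.
  move: forb_le; rewrite ltnNge subset_leq_card//; apply/subsetP => a _.
  exact: all_forb.
pose c' x := if x == u then a else c x.
have c'Y x : x \in Y -> c' x = c x.
  by rewrite /c'; case: eqP => // ->; rewrite (negbTE uY).
have c'u : c' u = a by rewrite /c' eqxx.
have aY x : e u x -> x \in Y -> a != c x.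
  move=> ux xY; apply: contraNneq aforb => ->; apply/setUP; left.
  by apply: imset_f; rewrite !inE ux.
exists c'; split.
  move=> x y; rewrite !inE => /predU1P[->|xY] /predU1P[->|yY].
  - by rewrite e_irr.
  - by move=> uy; rewrite c'u c'Y// aY.
  - by rewrite e_sym => ux; rewrite c'u c'Y// eq_sym aY.
  - by move=> xy; rewrite !c'Y// cY.
move=> v vlow vuY; have [vY0|vY] := eqVneq (N v :&: Y) set0.
  have only_u w : w \in N v :&: (u |: Y) -> w = u.
    rewrite in_setI in_setU1 => /andP[vw /predU1P[//|wY]].
    by have := in_set0 w; rewrite -vY0 in_setI vw wY.
  exists u; have [w wuY] := set0Pn _ vuY.
  have uuY : u \in N v :&: (u |: Y) by move: (wuY); rewrite (only_u w wuY).
  rewrite /unique_in uuY; apply/forall_inP => z /only_u ->.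
  by rewrite eqxx.
have [x xu] := clow v vlow vY.
have wu : unique_in c (N v :&: Y) (wit v).
  by rewrite /wit; case: pickP => [//|/(_ x)]; rewrite xu.
have [wvY /forall_inP wuniq] := andP wu.
have [vw wY] := setIP wvY.
(* The old witness survives: if [u] is a neighbour of [v], then [v] is a low neighbour of [u], so
   the colour of [wit v] was forbidden for [u]. *)
exists (wit v); rewrite /unique_in in_setI in_setU1 vw wY orbT /=.
apply/forall_inP => z /setIP[vz /setU1P[zu|zY]]; apply/implyP => zw.
  rewrite zu c'u c'Y//; apply: contraNneq aforb => ->; apply/setUP; right.
  apply: (imset_f (c \o wit)); rewrite in_setI vlow andbT inE e_sym.
  by move: vz; rewrite zu inE.
by rewrite !c'Y//; move: zw; apply/implyP; apply: wuniq; rewrite inE vz.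
Qed.

(** The induction removes a low vertex as long as [Y] contains one. Read forwards, low vertices are
    coloured last, as [greedy_step] requires. *)
Lemma greedy_exists (Y : {set T}) : exists c, greedy_good Y c.
Proof.
have [m] := ubnP #|Y|; elim: m Y => // m IH Y Ym.
have [->|[y yY]] := set_0Vmem Y.
  exists (fun=> ord0); split=> [u v|v _]; first by rewrite inE.
  by rewrite setI0 eqxx.
have [u uY ulow] : exists2 u, u \in Y & u \in low \/ (Y :\ u) :&: low = set0.
  have [Yl0|[u /setIP[uY ulow]]] := set_0Vmem (Y :&: low).
    exists y => //; right; apply/eqP; rewrite -subset0 -Yl0.
    by apply/setSI/subsetDl.
  by exists u => //; left.
have [c cY] : exists c, greedy_good (Y :\ u) c.
  by apply: IH; move: Ym; rewrite (cardsD1 u) uY.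
by rewrite -(setD1K uY); apply: greedy_step cY _ ulow; rewrite !inE eqxx.
Qed.
End Greedy.

(** Here [None] marks the vertices outside the random set. They get the greedy colours, shifted to a
    disjoint palette, so a colour unique among the neighbours on one side is never repeated from the
    other side. *)
Lemma combine_colourings (T : finType) (e : rel T) (low : {set T}) (q Delta : nat)
    (cS : T -> option 'I_q) :
  simple_graph e ->
  (forall v, (#|neighbours e v| <= Delta)%N) ->
  {in low, forall v, (2 * #|neighbours e v| <= Delta)%N} ->
  (forall u v, e u v -> cS u != None -> cS u != cS v) ->
  (forall v, neighbours e v != set0 ->
     (v \in low) && [exists u in neighbours e v, cS u == None] \/
     exists2 u, unique_in cS (neighbours e v) u & cS u != None) ->
  exists c : T -> 'I_(q + Delta.+1), proper_conflict_free_colouring e c.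
Proof.
move=> [e_sym e_irr] deg low_deg properS uniqS.
have [cW [properW uniqW]] :=
  greedy_exists e_sym e_irr deg low_deg [set x | cS x == None].
pose c x := if cS x is Some j then lshift Delta.+1 j else rshift q (cW x).
have c_Some u v : cS u != None -> cS v != cS u -> c v != c u.
  rewrite /c; case: (cS u) (cS v) => [j|//] [k|] _ => [kj|_].
    by rewrite (inj_eq (@lshift_inj _ _)).
  by rewrite eq_rlshift.
have c_None u v : cS u == None -> (cS v == None -> cW v != cW u) -> c v != c u.
  rewrite /c; case: (cS u) => // _; case: (cS v) => [j|] H.
    by rewrite eq_lrshift.
  by rewrite (inj_eq (@rshift_inj _ _)) H.
exists c; split=> [u v uv|v vN0].
  have [cu0|cu0] := boolP (cS v == None).
    by apply: c_None => // cv0; apply: properW; rewrite ?inE.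
  by apply: c_Some => //; rewrite eq_sym; apply: properS; rewrite // e_sym.
have [/andP[vlow /existsP[x /andP[xv x0]]]|] := uniqS v vN0.
  have [|u /andP[/setIP[uv u0] /forall_inP uniq]] := uniqW v vlow.
    by apply/set0Pn; exists x; rewrite inE xv inE.
  exists u => // w wv wu; apply: c_None => [|w0]; first by rewrite inE in u0.
  by move: wu; apply/implyP/uniq; rewrite !inE in wv *; rewrite wv.
case=> u /andP[uv /forall_inP uniq] u0; exists u => // w wv wu.
by apply: c_Some => //; move: wu; apply/implyP/uniq.
Qed.

(** * Random bits and the probabilities of the bad events *)

Section RandomBits.
Variables (R : realFieldType) (T : finType) (q n : nat).
Variables (e : rel T) (low : {set T}).
Hypothesis e_irr : irreflexive e.
Local Notation N := (neighbours e).
Local Notation Omega := {ffun T * 'I_q -> 'I_n.+1}.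
Local Notation Pr := (@prob R (T * 'I_q)%type n).
Local Notation r := (n.+1%:R^-1 : R).
Implicit Types (f : Omega) (x z u v : T) (j k : 'I_q).

Definition bit x j f : bool := f (x, j) == ord0.

Definition holds_colour x f : bool := [exists j, bit x j f].

Definition sole_bit v j f : bool :=
  [exists x in N v, [forall z in N v, bit z j f == (z == x)]].

Definition edge_event u v f : bool :=
  e u v && [exists j, bit u j f && bit v j f].

Definition multi_event x f : bool :=
  [exists jk : 'I_q * 'I_q, (jk.1 != jk.2) && (bit x jk.1 f && bit x jk.2 f)].

(** The first conjunct guarantees a nonempty scope, as the local lemma demands. The last one
    reflects that a low vertex with an uncoloured neighbour is served by the greedy stage. *)
Definition nbr_event v f : bool :=
  [&& N v != set0, [forall j, ~~ sole_bit v j f]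
    & (v \in low) ==> [forall x in N v, holds_colour x f]].

Lemma depends_bit x j : depends_on (bit x j) [set (x, j)].
Proof. by move=> f g fg; rewrite /bit fg ?inE. Qed.

Lemma depends_holds_colour x :
  depends_on (holds_colour x) (@fst T 'I_q @^-1: [set x]).
Proof.
by move=> f g fg; apply: eq_existsb => j; rewrite /bit fg// !inE.
Qed.

Lemma depends_edge u v :
  depends_on (edge_event u v) (@fst T 'I_q @^-1: [set u; v]).
Proof.
move=> f g fg; congr (_ && _); apply: eq_existsb => j.
by rewrite /bit !fg// !inE eqxx ?orbT.
Qed.

Lemma depends_multi x : depends_on (multi_event x) (@fst T 'I_q @^-1: [set x]).
Proof.
by move=> f g fg; apply: eq_existsb => jk; rewrite /bit !fg// !inE.
Qed.

Lemma depends_sole v j : depends_on (sole_bit v j) (@snd T 'I_q @^-1: [set j]).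
Proof.
move=> f g fg; apply: eq_existsb => x; congr (_ && _).
by apply: eq_forallb => z; rewrite /bit fg// !inE.
Qed.

Lemma depends_nbr v : depends_on (nbr_event v) (@fst T 'I_q @^-1: N v).
Proof.
move=> f g fg.
have bitE x j : x \in N v -> bit x j f = bit x j g.
  by move=> xv; rewrite /bit fg// in_set.
congr [&& _, _ & _].
  apply: eq_forallb => j; congr (~~ _); apply: eq_existsb => x; congr (_ && _).
  by apply: eq_forallb_in => z zv; rewrite bitE.
congr (_ ==> _); apply: eq_forallb_in => x xv; apply: eq_existsb => j.
exact: bitE.
Qed.

Lemma prob_bit x j : Pr (bit x j) = r.
Proof. exact: prob_coord. Qed.

Lemma prob_bit2 x j z k : (x, j) != (z, k) ->
  Pr (fun f => bit x j f && bit z k f) = r ^+ 2.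
Proof.
move=> xz; rewrite (prob_indep (S := [set (x, j)])).
- by rewrite !prob_bit.
- exact: depends_bit.
- apply: (depends_onW _ (@depends_bit z k)); rewrite sub1set !inE.
  by rewrite eq_sym.
Qed.

Lemma prob_holds_colour x : Pr (holds_colour x) <= q%:R * r.
Proof.
apply: le_trans (prob_union_le _ predT (bit x)) _.
under eq_bigr do rewrite prob_bit.
by rewrite sumr_const card_ord mulr_natl.
Qed.

Lemma prob_edge u v : Pr (edge_event u v) <= (e u v)%:R * (q%:R * r ^+ 2).
Proof.
have [uv|uv] := boolP (e u v); last first.
  rewrite mul0r (eq_prob (fun=> ~~ true)) ?prob_compl ?prob_true ?subrr//.
  by move=> f; rewrite /edge_event (negbTE uv).
rewrite mul1r.
apply: le_trans (prob_sub (fun f =>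
  [exists j in predT, bit u j f && bit v j f]) _) _.
  by move=> f /andP[].
apply: le_trans (prob_union_le _ _ _) _.
rewrite (eq_bigr (fun=> r ^+ 2)) => [|j _].
  by rewrite sumr_const card_ord mulr_natl.
by apply: prob_bit2; apply: contraTneq uv => -[->]; rewrite e_irr.
Qed.

Lemma prob_multi x : Pr (multi_event x) <= (q%:R * r) ^+ 2.
Proof.
apply: le_trans (prob_union_le _ (fun jk => jk.1 != jk.2)
  (fun jk f => bit x jk.1 f && bit x jk.2 f)) _.
rewrite (eq_bigr (fun=> r ^+ 2)) => [|[j k] jk]; last first.
  by apply: prob_bit2; apply: contraNneq jk => -[->].
rewrite sumr_const -[leLHS]mulr_natl exprMn -natrX.
rewrite ler_wpM2r ?exprn_ge0 ?invr_ge0 ?ler0n// ler_nat.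
by rewrite (leq_trans (max_card _))// card_prod !card_ord.
Qed.

(** Fix a neighbour [u0]. It holds some colour [j], which is not sole, so another neighbour [w]
    holds [j] too; the remaining neighbours each hold some colour. The union over [w] and [j] gives
    the bound, since bits of different vertices are independent. *)
Lemma prob_nbr_low v : v \in low ->
  Pr (nbr_event v) <=
    #|N v|.-1%:R * (q%:R * r ^+ 2 * (q%:R * r) ^+ (#|N v| - 2)).
Proof.
move=> vlow; have [vN0|[u0 u0v]] := set_0Vmem (N v).
  rewrite vN0 cards0 mul0r (eq_prob (fun=> ~~ true)).
    by rewrite prob_compl prob_true ?subrr.
  by move=> f; rewrite /nbr_event vN0 eqxx.
(* What the configuration given by [w] and [j] demands of the neighbour [z]. *)
pose A w j z f := if z \in [set u0; w] then bit z j f else holds_colour z f.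
apply: le_trans (prob_sub (fun f => [exists w in N v :\ u0,
    [exists j in predT, [forall z in N v, A w j z f]]]) _) _.
  move=> f /and3P[_ /forallP nosole]; rewrite vlow /= => /forall_inP held.
  have [j u0j] := existsP (held _ u0v).
  have := nosole j; rewrite negb_exists => /forallP/(_ u0).
  rewrite u0v /= => /forall_inPn[w wv].
  have [->|wu0] := eqVneq w u0; first by rewrite u0j.
  rewrite eqbF_neg negbK => wj.
  apply/exists_inP; exists w; first by rewrite in_setD1 wu0.
  apply/exists_inP; exists j => //; apply/forall_inP => z zv.
  rewrite /A !inE; case: eqVneq => [->//|_]; case: eqVneq => [->//|_] /=.
  exact: held.
apply: le_trans (prob_union_le _ _ _) _.
have dN : #|N v| = #|N v :\ u0|.+1 by rewrite (cardsD1 u0) u0v.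
rewrite dN /= mulr_natl -sumr_const; apply: ler_sum => w wv.
have [wu0 wv'] : w != u0 /\ w \in N v by move: wv; rewrite in_setD1 => /andP.
apply: le_trans (prob_union_le _ _ _) _.
rewrite -mulrA mulr_natl -[X in _ *+ X]card_ord -sumr_const.
apply: ler_sum => j _.
have dA z : depends_on (A w j z) (@fst T 'I_q @^-1: [set z]).
  move=> f g fg; rewrite /A; case: ifP => _; last exact: depends_holds_colour fg.
  by rewrite /bit fg ?inE.
rewrite (prob_indep_all (N v) dA) (big_setD1 u0)//= (big_setD1 w)//=.
rewrite mulrA expr2; apply: ler_pM.
- by rewrite mulr_ge0 ?prob_ge0.
- by rewrite prodr_ge0// => z _; rewrite prob_ge0.
- by rewrite /A !inE !eqxx orbT !prob_bit.
rewrite (cardsD1 w) wv subSS add1n subn1 /= -prodr_const.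
apply: ler_prod => z; rewrite !in_setD1 => /and3P[zw zu0 _].
by rewrite prob_ge0 /A !inE (negbTE zw) (negbTE zu0) prob_holds_colour.
Qed.

Lemma prob_sole v j :
  Pr (sole_bit v j) = #|N v|%:R * (r * (1 - r) ^+ #|N v|.-1).
Proof.
rewrite prob_union_disjoint; last first.
  move=> f x y xv yv /forall_inP/(_ x xv) + /forall_inP/(_ x xv).
  by rewrite eqxx => /eqP-> /eqP/esym/eqP.
rewrite mulr_natl -sumr_const; apply: eq_bigr => x xv.
have dA z : depends_on (fun f => bit z j f == (z == x)) (@fst T 'I_q @^-1: [set z]).
  move=> f g fg; congr (_ == _).
  by rewrite /bit fg ?inE.
rewrite (prob_indep_all (N v) dA) (big_setD1 x)//=; congr (_ * _).
  by rewrite -(prob_bit x j); apply: eq_prob => f; rewrite eqxx eqb_id.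
rewrite (cardsD1 x) xv add1n /= -prodr_const; apply: eq_bigr => z.
rewrite !inE => /andP[/negbTE zx _].
rewrite -[in RHS](prob_bit z j) -prob_compl; apply: eq_prob => f.
by rewrite zx eqbF_neg.
Qed.

(** This is where separate bits per colour pay off: the events [sole_bit v j] for different [j] read
    disjoint sets of bits, hence the power [q]. *)
Lemma prob_nbr_high v :
  Pr (nbr_event v) <= (1 - #|N v|%:R * (r * (1 - r) ^+ #|N v|.-1)) ^+ q.
Proof.
apply: le_trans (prob_sub (fun f =>
  [forall j in [set: 'I_q], ~~ sole_bit v j f]) _) _.
  move=> f /and3P[_ /forallP nosole _].
  by apply/forall_inP => j _; apply: nosole.
rewrite (prob_indep_all (h := @snd T 'I_q) setT) => [|j f g fg]; last first.
  by congr (~~ _); apply: depends_sole.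
under eq_bigr do rewrite prob_compl prob_sole.
by rewrite prodr_const cardsT card_ord.
Qed.

End RandomBits.

(** * Estimates for the weights in the local lemma: probability divided by a power of [1 - p / 8] *)

Section Numeric.
Variable R : realType.
Implicit Types (p r x : R) (d q : nat).

Lemma Bernoulli_ge r d : 0 <= r <= 1 -> 1 - d%:R * r <= (1 - r) ^+ d.
Proof.
move=> /andP[r0 r1]; elim: d => [|d IH]; first by rewrite mul0r subr0 expr0.
have := ler_wpM2l (_ : 0 <= 1 - r) IH; rewrite subr_ge0 -exprS => /(_ r1).
apply: le_trans; rewrite -natr1.
have : 0 <= d%:R * r * r by rewrite !mulr_ge0.
nra.
Qed.

(** For [d = k + 2] one has [k + 1 <= 2 ^ k] and [2 * p <= 1 - p / 8], which cancels [k] of the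
    factors below; the one left is at least 1/2. *)
Lemma low_weight p d : 0 <= p <= 64^-1 ->
  d.-1%:R * p ^+ (d - 2) / (1 - p / 8) ^+ d.-1 <= 2.
Proof.
move=> /andP[p0 p1].
have b2 : 2^-1 <= 1 - p / 8 by lra.
have b0 : 0 < 1 - p / 8 by lra.
case: d => [|[|k]]; rewrite ?mul0r ?ler0n//= !subSS subn0.
rewrite ler_pdivrMr ?exprn_gt0//.
apply: (@le_trans _ _ (2 ^+ k * p ^+ k)).
  by rewrite ler_wpM2r ?exprn_ge0// -natrX ler_nat ltn_expl.
rewrite -exprMn exprS mulrA.
apply: (@le_trans _ _ (1 * (1 - p / 8) ^+ k)).
  by rewrite mul1r lerXn2r ?nnegrE; lra.
by rewrite ler_wpM2r ?exprn_ge0; lra.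
Qed.

(** By Bernoulli a given colour is sole with probability at least [63/64 * d * r], so the numerator
    is at most [exp (- 63/64 * p * d)]. The denominator costs at most [exp (p * d / 4)], and
    [63/64 - 1/4] exceeds 1/2. *)
Lemma high_weight r q d : 0 <= r -> d%:R * r <= 64^-1 -> q%:R * r <= 64^-1 ->
  (1 - d%:R * (r * (1 - r) ^+ d.-1)) ^+ q / (1 - q%:R * r / 8) ^+ d.-1
    <= expR (- (q%:R * r * d%:R / 2)).
Proof.
move=> r0 dr qr; case: d dr => [|d] dr.
  by rewrite !mul0r subr0 expr1n expr0 mulr0 mul0r oppr0 expR0 divr1.
have dr0 : 0 <= d%:R * r by rewrite mulr_ge0.
have r1 : r <= 64^-1 by move: dr; rewrite -natr1; lra.
have p0 : 0 <= q%:R * r by rewrite mulr_ge0.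
set p := q%:R * r in qr p0 *; rewrite [d.+1.-1]/=.
set x := d.+1%:R * _.
have x_ge : 63 / 64 * (d.+1%:R * r) <= x.
  rewrite /x mulrA mulrC ler_wpM2l ?mulr_ge0//.
  apply: le_trans (Bernoulli_ge d _); last by lra.
  by move: dr; rewrite -natr1; lra.
have x_le : x <= 1.
  apply: (@le_trans _ _ (d.+1%:R * r)); last by lra.
  rewrite /x mulrA ler_piMr ?mulr_ge0// exprn_ile1//; lra.
have xq : (1 - x) ^+ q <= expR (- (63 / 64 * (p * d.+1%:R))).
  apply: (@le_trans _ _ (expR (- x) ^+ q)).
    apply: lerXn2r; rewrite ?nnegrE ?expR_ge0 ?subr_ge0//; exact: expR_ge1Dx.
  rewrite -expRM_natl ler_expR mulrN lerN2.
  have := ler_wpM2l (ler0n R q) x_ge; rewrite /p; lra.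
clearbody p.
(* This rests on [1 / (1 - p / 8) <= 1 + p / 4], valid for small [p]. *)
have bd : ((1 - p / 8) ^+ d)^-1 <= expR (p / 4 * d.+1%:R).
  rewrite -exprVn; apply: (@le_trans _ _ (expR (p / 4) ^+ d)).
    rewrite lerXn2r ?nnegrE ?expR_ge0 ?invr_ge0; try lra.
    apply: le_trans (expR_ge1Dx _).
    have p2 : p * p <= 64^-1 * p by rewrite ler_wpM2r.
    by rewrite -[leLHS]mul1r ler_pdivrMr; lra.
  rewrite -expRM_natl ler_expR -[d.+1%:R]natr1; lra.
apply: le_trans (ler_pM _ _ xq bd) _.
- by rewrite exprn_ge0 ?subr_ge0.
- by rewrite invr_ge0 exprn_ge0; lra.
rewrite -expRD ler_expR.
have : 0 <= p * d.+1%:R by rewrite mulr_ge0.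
lra.
Qed.
End Numeric.

(** * The local lemma applied to the random bits *)

(** The last hypothesis makes the neighbourhood event of a vertex outside [low] weigh no more than
    that of a low one, namely at most [2 * q * r ^ 2]. *)
Lemma partial_colouring_exists (R : realType) (T : finType) (e : rel T)
    (low : {set T}) (q Delta : nat) :
  simple_graph e ->
  (forall v, (#|neighbours e v| <= Delta)%N) ->
  (0 < q <= Delta)%N ->
  (forall v, v \notin low ->
    expR (- (q%:R / (64 * Delta%:R) * #|neighbours e v|%:R / 2))
      <= 2 * (q%:R / (64 * Delta%:R) ^+ 2) :> R) ->
  exists cS : T -> option 'I_q,
    (forall u v, e u v -> cS u != None -> cS u != cS v) /\
    (forall v, neighbours e v != set0 ->
     (v \in low) && [exists u in neighbours e v, cS u == None] \/
     exists2 u, unique_in cS (neighbours e v) u & cS u != None).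
Proof.
move=> [e_sym e_irr] deg /andP[q0 qD] high.
have D0 : (0 < Delta)%N by apply: leq_trans qD.
(* A bit then has probability [r = 1 / (64 * Delta)], and [p = q * r], which bounds the chance that
   a vertex holds a colour, is at most 1/64. *)
have [n nE] : exists n, n.+1 = (64 * Delta)%N by exists (64 * Delta).-1; lia.
pose K : finType := ((T * T) + T + T)%type.
pose ev (k : K) : pred {ffun T * 'I_q -> 'I_n.+1} := match k with
  | inl (inl uv) => edge_event e uv.1 uv.2
  | inl (inr x) => multi_event x
  | inr v => nbr_event e low v end.
pose sc (k : K) : {set T} := match k with
  | inl (inl uv) => [set uv.1; uv.2]
  | inl (inr x) => [set x]
  | inr v => neighbours e v end.
pose r : R := n.+1%:R^-1; pose p : R := q%:R * r; pose b := 1 - p / 8.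
have rE : r = (64 * Delta%:R)^-1 by rewrite /r nE natrM.
have r0 : 0 < r by rewrite invr_gt0 ltr0n.
have D0R : 0 < Delta%:R :> R by rewrite ltr0n.
have Dr : Delta%:R * r = 64^-1.
  by rewrite rE invfM mulrCA divff ?mulr1 ?lt0r_neq0.
have p0 : 0 < p by rewrite mulr_gt0// ltr0n.
have p1 : p <= 64^-1 by rewrite -Dr ler_wpM2r ?(ltW r0)// ler_nat.
have b2 : 2^-1 <= b by rewrite /b; lra.
have b0 : 0 < b by lra.
have qr2 : 0 <= q%:R * r ^+ 2 by rewrite mulr_ge0// exprn_ge0// ltW.
have edge_le uv : prob R (ev (inl (inl uv))) / b ^+ #|sc (inl (inl uv))|.-1 <=
    (e uv.1 uv.2)%:R * (q%:R * r ^+ 2 / b).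
  have := @prob_edge R T q n e e_irr uv.1 uv.2; rewrite -/r => pe.
  have [ee|ee] := boolP (e uv.1 uv.2); rewrite ?ee ?(negbTE ee) in pe *.
    have -> : #|sc (inl (inl uv))|.-1 = 1%N.
      rewrite /sc cards2 (_ : uv.1 != uv.2)//.
      by apply: contraTneq ee => ->; rewrite e_irr.
    by rewrite expr1 mul1r ler_wpM2r ?invr_ge0 ?(ltW b0)// -[leRHS]mul1r.
  rewrite mul0r ler_pdivrMr ?exprn_gt0// mul0r.
  by rewrite mul0r in pe.
have nbr_le v : prob R (ev (inr v)) / b ^+ #|sc (inr v)|.-1 <=
    2 * (q%:R * r ^+ 2).
  have bd0 : 0 <= (b ^+ #|neighbours e v|.-1)^-1.
    by rewrite invr_ge0 exprn_ge0// ltW.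
  rewrite /=; have [vlow|vlow] := boolP (v \in low).
    apply: (le_trans (ler_wpM2r bd0 (prob_nbr_low R q n e vlow))).
    have pP : 0 <= p <= 64^-1 by rewrite (ltW p0).
    apply: le_trans (ler_wpM2r qr2 (low_weight _ pP)).
    by rewrite -/b -/r -/p le_eqVlt; apply/orP; left; apply/eqP; ring.
  apply: (le_trans (ler_wpM2r bd0 (prob_nbr_high R q n e low v))).
  apply: le_trans (high_weight (ltW r0) _ p1) _.
    by rewrite -Dr ler_wpM2r ?(ltW r0)// ler_nat.
  by move: (high v vlow); rewrite -exprVn -rE.
have [f avoid] : exists f, forall k, ~~ ev k f.
  apply: (avoid_events_ex (@fst T 'I_q) sc b0).
  - case=> [[[u v]|x]|v]; [exact: depends_edge|exact: depends_multi|].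
    exact: depends_nbr.
  - case=> [[[u v]|x]|v] f; rewrite /ev /sc => H; last by case/and3P: H.
      by apply/set0Pn; exists u; rewrite !inE eqxx.
    by apply/set0Pn; exists x; rewrite inE.
  move=> u; rewrite !big_sumType /=.
  have edge_sum : \sum_(uv | u \in sc (inl (inl uv)))
     prob R (ev (inl (inl uv))) / b ^+ #|sc (inl (inl uv))|.-1 <= p / 16.
    apply: le_trans (ler_sum _ (fun uv _ => edge_le uv)) _.
    rewrite -mulr_suml -natr_sum.
    (* Edge events are indexed by ordered pairs, and [u] may be either end: hence the factor 2. *)
    have cnt : (\sum_(uv | u \in [set uv.1; uv.2]) e uv.1 uv.2 <= 2 * Delta)%N.
      rewrite -big_mkcondr /= sum1dep_card.
      apply: leq_trans (_ : _ <= #|[set (u, x) | x in neighbours e u] :|: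
          [set (x, u) | x in neighbours e u]|)%N _.
        apply/subset_leq_card/subsetP => -[x y]; rewrite !inE /=.
        case/andP=> /orP[] /eqP <- xy; apply/orP.
          by left; apply: imset_f; rewrite inE.
        by right; apply: (imset_f (fun x => (x, u))); rewrite inE e_sym.
      rewrite (leq_trans (leq_card_setU _ _))// mul2n -addnn leq_add//.
        exact: leq_trans (leq_imset_card _ _) (deg u).
      exact: leq_trans (leq_imset_card _ _) (deg u).
    apply: (@le_trans _ _ ((2 * Delta)%:R * (q%:R * r ^+ 2 / b))).
      by rewrite ler_wpM2r ?ler_nat// divr_ge0// ltW.
    have -> : (2 * Delta)%:R * (q%:R * r ^+ 2 / b) = p / 32 / b.
      rewrite natrM /p; transitivity (2 * (Delta%:R * r) * (q%:R * r) / b).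
        by ring.
      by rewrite Dr; field; rewrite lt0r_neq0.
    by rewrite ler_pdivrMr//; nra.
  have multi_sum : \sum_(x | u \in sc (inl (inr x)))
     prob R (ev (inl (inr x))) / b ^+ #|sc (inl (inr x))|.-1 <= p / 64.
    rewrite (big_pred1 u) => [|x]; last by rewrite inE eq_sym.
    rewrite /= cards1 expr0 divr1; apply: (le_trans (prob_multi R q n u)).
    by rewrite -/r -/p expr2 ler_wpM2l ?(ltW p0).
  have nbr_sum : \sum_(v | u \in sc (inr v))
     prob R (ev (inr v)) / b ^+ #|sc (inr v)|.-1 <= p / 32.
    apply: le_trans (ler_sum _ (fun v _ => nbr_le v)) _.
    rewrite (eq_bigl (mem (neighbours e u))) => [|v]; last first.
      by rewrite /= !inE e_sym.
    rewrite sumr_const -[leLHS]mulr_natl.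
    apply: (@le_trans _ _ (Delta%:R * (2 * (q%:R * r ^+ 2)))).
      by rewrite ler_wpM2r ?ler_nat// mulr_ge0.
    rewrite /p; have -> : Delta%:R * (2 * (q%:R * r ^+ 2)) =
      2 * (Delta%:R * r) * (q%:R * r) by ring.
    by rewrite Dr; lra.
  (* The weights add up to [7 * p / 64], within the allowance [1 - b = p / 8]. *)
  apply: le_trans (lerD (lerD edge_sum multi_sum) nbr_sum) _.
  by rewrite /b; lra.
(* A vertex without bits gets [None]; avoiding [multi_event] makes the picked colour the only
   one. *)
exists (fun x => [pick j | bit x j f]).
have bitE x j : bit x j f -> [pick j | bit x j f] = Some j.
  case: pickP => [k xk xj|/(_ j) ->//]; congr Some; apply/eqP/negPn/negP => kj.
  have /existsP[] := avoid (inl (inr x)).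
  by exists (k, j); rewrite kj xk.
have bitS x j : [pick j | bit x j f] = Some j -> bit x j f.
  by case: pickP => // k xk [<-].
split=> [u v uv|v vN0].
  case ju: [pick j | bit u j f] => [j|//] _; rewrite eq_sym; apply/eqP => jv.
  have /negP := avoid (inl (inl (u, v))); apply; rewrite /= /edge_event uv /=.
  by apply/existsP; exists j; rewrite !bitS.
have := avoid (inr v); rewrite /= /nbr_event vN0 /= negb_and => /orP[].
  rewrite negb_forall => /existsP[j]; rewrite negbK => /existsP[x].
  case/andP=> xv /forall_inP sole; right.
  have xj : bit x j f by move: (sole x xv); rewrite eqxx => /eqP.
  exists x; last by rewrite (bitE _ _ xj).
  rewrite /unique_in xv; apply/forall_inP => w wv; apply/implyP => wx.
  rewrite (bitE _ _ xj); apply/eqP => /bitS wj.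
  by move: (sole w wv); rewrite wj (negbTE wx).
rewrite negb_imply => /andP[-> /forall_inPn[x xv]].
rewrite negb_exists => /forallP nox; left; apply/existsP; exists x.
by rewrite xv /=; case: pickP => // j; rewrite (negbTE (nox j)).
Qed.

(** * Choice of the parameters and the final count of colours *)

Lemma double_le_of_cube_lt (d m : nat) :
  (2 <= m)%N -> (d ^ 3 < m)%N -> (2 * d <= m)%N.
Proof. by case: d => [|[|d]]; rewrite ?expnS ?expn0; nia. Qed.

Theorem theorem1 (R : realType) :
  exists2 Delta0 : nat, (0 < Delta0)%N &
    forall Delta : nat, (Delta0 <= Delta)%N ->
    forall (T : finType) (e : rel T),
      simple_graph e -> (max_degree e <= Delta)%N ->
      exists (k : nat) (c : T -> 'I_k),
        proper_conflict_free_colouring e c /\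
        k%:R <= Delta%:R
                 + (10 ^+ 5 + 106) * Delta%:R `^ (2 / 3) * ln Delta%:R :> R.
Proof.
(* This bound makes the sixth root [s] of [Delta] at least 1600. In terms of [s] all exponents are
   integers: [Delta] is [s ^ 6], its cube root [s ^ 2], its power 2/3 [s ^ 4]. *)
exists (Num.bound (1600 ^+ 6 : R)).+1 => // Delta DeltaB T e simple_e degD.
have deg v : (#|neighbours e v| <= Delta)%N.
  exact: leq_trans (leq_bigmax v) degD.
pose x : R := Delta%:R; pose s : R := x `^ (1 / 6).
have x_big : 1600 ^+ 6 <= x.
  apply: ltW; apply: lt_le_trans (archi_boundP _) _; first by rewrite exprn_ge0.
  by rewrite ler_nat (leq_trans (leqnSn _)).
have x0 : 0 < x by apply: lt_le_trans x_big; rewrite exprn_gt0.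
have s0 : 0 <= s by exact: powR_ge0.
have sX : s ^+ 6 = x.
  by rewrite -powR_mulrn// -powRrM divfK; [exact/powRr1/ltW|rewrite pnatr_eq0].
have s_big : 1600 <= s by rewrite -(@ler_pXn2r _ 6) ?nnegrE// sX.
have s_gt0 : 0 < s by apply: lt_le_trans s_big.
have -> : Delta%:R `^ (2 / 3) = s ^+ 4.
  by rewrite -powR_mulrn// -powRrM; congr (_ `^ _); field.
rewrite -/x; set L := ln x.
have L_ge : 2^-1 <= L.
  rewrite -ler_expR lnK ?posrE//.
  have : expR (- 2^-1) >= 2^-1 :> R by apply: le_trans (expR_ge1Dx _); lra.
  rewrite expRN lef_pV2 ?posrE ?expR_gt0// => /le_trans; apply.
  by apply: le_trans x_big; rewrite -natrX ler_nat.
have L_le : L <= 6 * s.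
  rewrite /L -sX lnXn// -[leLHS]mulr_natl ler_wpM2l//.
  exact/ltW/ln_sublinear.
pose y := 256 * s ^+ 4 * L.
have s4 : 1600 ^+ 4 <= s ^+ 4 by rewrite lerXn2r ?nnegrE.
have y_ge : 2048 <= y.
  apply: (@le_trans _ _ (256 * 1600 ^+ 4 * 2^-1)); first by lra.
  by apply: ler_pM => //; rewrite ?ler_wpM2l//; lra.
(* The origin of 1600: [L <= 6 * s] gives [y <= 1536 * s ^ 5], and [1536 * s ^ 5 + 1 <= 1600 * s ^ 5
   <= s ^ 6]. *)
have y_le : y + 1 <= x.
  have s5 : 1 <= s ^+ 5 by rewrite exprn_ege1//; lra.
  have : y <= 256 * s ^+ 4 * (6 * s) by rewrite ler_wpM2l// mulr_ge0// exprn_ge0.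
  rewrite mulrACA -exprSr -sX (exprS s 5).
  have := ler_wpM2r (ltW (lt_le_trans ltr01 s5)) s_big; lra.
have y0 : 0 <= y by lra.
have /andP[qy yq] := truncn_itv y0.
pose q := (Num.truncn y).+1.
have qR : q%:R <= y + 1 by rewrite -natr1 lerD2r.
have q_ge : y <= q%:R by rewrite ltW.
have qD : (0 < q <= Delta)%N by rewrite /= -(ler_nat R) (le_trans qR).
pose low := [set v | #|neighbours e v| ^ 3 < Delta]%N.
have low_deg : {in low, forall v, (2 * #|neighbours e v| <= Delta)%N}.
  have : (2 <= Delta)%N.
    by rewrite -(ler_nat R); apply: le_trans x_big; rewrite -natrX ler_nat.
  by move=> D2 v; rewrite inE; apply: double_le_of_cube_lt.
have high v : v \notin low ->
    expR (- (q%:R / (64 * x) * #|neighbours e v|%:R / 2))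
      <= 2 * (q%:R / (64 * x) ^+ 2).
  rewrite inE -leqNgt -(ler_nat R) natrX -/x -sX; set d := #|_| => sd.
  have {}sd : s ^+ 2 <= d%:R.
    rewrite -(@ler_pXn2r _ 3) ?nnegrE ?exprn_ge0//.
    by rewrite -exprM.
  rewrite sX.
  (* The factor 256 in [y] is chosen for this: [256 * s ^ 4 * L * s ^ 2 / (128 * s ^ 6)] is [2 * L],
     so the exponential is at most [x ^ (-2)]. The right-hand side is [q / 2048] times that, and
     [q >= 2048]. *)
  apply: (@le_trans _ _ (expR (- (2%:R * L)))).
    rewrite ler_expR lerN2.
    have -> : q%:R / (64 * x) * d%:R / 2 = q%:R * d%:R / (128 * x).
      by field; rewrite lt0r_neq0.
    rewrite ler_pdivlMr ?mulr_gt0//.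
    have : y * s ^+ 2 <= q%:R * d%:R by rewrite ler_pM ?exprn_ge0.
    by apply: le_trans; rewrite /y -sX le_eqVlt; apply/orP; left; apply/eqP; ring.
  rewrite expRN expRM_natl lnK ?posrE//.
  have -> : 2 * (q%:R / (64 * x) ^+ 2) = q%:R / 2048 * (x ^+ 2)^-1.
    by field; rewrite lt0r_neq0.
  rewrite -[leLHS]mul1r ler_wpM2r ?invr_ge0 ?exprn_ge0 ?(ltW x0)//.
  by rewrite ler_pdivlMr// mul1r (le_trans y_ge).
have [cS [properS uniqS]] := partial_colouring_exists simple_e deg qD high.
have [c pcf] := combine_colourings simple_e deg low_deg properS uniqS.
exists (q + Delta.+1)%N, c; split=> //.
(* It remains to bound [q + 1 <= y + 2], which is at most [2 * y = 512 * s ^ 4 * L], far below the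
   stated constant. *)
rewrite natrD -natr1 -/x addrCA lerD2l.
have : 0 <= s ^+ 4 * L by rewrite mulr_ge0 ?exprn_ge0//; lra.
move: qR y_ge; rewrite /y; lra.
Qed.
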